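(* Let $R$ be a unitary ring, let $d\in R$ be regular and let $a\in R$ be invertible along $d$. Then the following statements are equivalent. (i) $aa^{\parallel d}=a^{\parallel d}a$. (ii) $d$ is group invertible and $ap_d=p_da$. (iii) $d$ is group invertible and $a=x+m$, where $x\in((1-p_d)R(1-p_d))^{-1}$ and $m\in p_dRp_d$.
   Context: $R$ is an associative ring with unit $1$. An element $d$ is regular if there is $z\in R$ with $d=dzd$. An element $a$ is invertible along $d$ if there is $b\in R$ with $b=bab$, $bR=dR$ and $Rb=Rd$; such $b$ is unique and is denoted $a^{\parallel d}$. An element $d\in R$ is group invertible if there is a (necessarily unique) $d^\sharp\in R$ with $dd^\sharp d=d$, $d^\sharp dd^\sharp=d^\sharp$, $dd^\sharp=d^\sharp d$; in that case $p_d:=1-d^\sharp d$. For an idempotent $q\in R$, $qRq$ is a ring with unit $q$ and $(qRq)^{-1}$ denotes its set of invertible elements (if $q=0$ this is $\{0\}$). *)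

(* Defs.v *)
From HB Require Import structures.
From mathcomp Require Import all_boot all_algebra.

Set Implicit Arguments.
Unset Strict Implicit.
Unset Printing Implicit Defensive.

Import GRing.Theory.
Local Open Scope ring_scope.

(* Rings are [pzRingType]s: associative, with unit, possibly trivial. *)

Definition regular (R : pzRingType) (d : R) : Prop :=
  exists z : R, d = d * z * d.

Definition right_ideal (R : pzRingType) (d x : R) : Prop :=
  exists r : R, x = d * r.

Definition left_ideal (R : pzRingType) (d x : R) : Prop :=
  exists r : R, x = r * d.

Definition is_inverse_along (R : pzRingType) (a d b : R) : Prop :=
  [/\ b = b * a * b,
      forall x, right_ideal b x <-> right_ideal d x
    & forall x, left_ideal b x <-> left_ideal d x].

Definition is_group_inverse (R : pzRingType) (d e : R) : Prop :=
  [/\ d * e * d = d, e * d * e = e & d * e = e * d].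

(* Membership in the corner ring qRq, and in its group of units; the unit of
   qRq is q, not 1.  Both predicates are meant for idempotent q. *)
Definition corner (R : pzRingType) (q x : R) : Prop :=
  exists r : R, x = q * r * q.

Definition corner_unit (R : pzRingType) (q x : R) : Prop :=
  corner q x /\ exists y : R, [/\ corner q y, x * y = q & y * x = q].

(* The two inverses are treated as relations; these lemmas justify speaking of
   "the" inverse along d and "the" group inverse. *)
Lemma inverse_along_uniq (R : pzRingType) (a d b c : R) :
  is_inverse_along a d b -> is_inverse_along a d c -> b = c.
Proof.
move=> [bE br bl] [cE cr cl].
have [r Eb] : right_ideal c b.
  by apply/cr/br; exists 1; rewrite mulr1.
have [s Ec] : left_ideal b c.
  by apply/bl/cl; exists 1; rewrite mul1r.
have cab : c * a * b = b by rewrite {1}Eb mulrA -cE -Eb.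
have : c * a * b = c by rewrite {1}Ec -!mulrA (mulrA b) -bE -Ec.
by rewrite cab.
Qed.

Lemma group_inverse_uniq (R : pzRingType) (d e f : R) :
  is_group_inverse d e -> is_group_inverse d f -> e = f.
Proof.
move=> [ded ede de] [dfd fdf df].
have E : e * d = f * d.
  have Ee : e * d = e * d * (f * d) by rewrite -{1}dfd !mulrA.
  have Ef : f * d = e * d * (f * d) by rewrite -df -de mulrA ded.
  by rewrite Ee -Ef.
have E' : d * e = d * f by rewrite de df E.
by rewrite -ede E -mulrA E' mulrA fdf.
Qed.

(* Main.v *)
Require Import Defs.
From HB Require Import structures.
From mathcomp Require Import all_boot all_algebra.

Set Implicit Arguments.
Unset Strict Implicit.
Unset Printing Implicit Defensive.

Import GRing.Theory.
Local Open Scope ring_scope.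

(** Write [b] for the inverse of [a] along [d].  Since [b] and [d] generate the
    same one-sided ideals, the idempotents [b * a] and [a * b] fix [d] from the
    left and from the right ([inverse_alongKl], [inverse_alongKr]).  The idea is
    that each of the three conditions says that [d] lives, as a unit, in a
    corner ring qRq whose idempotent q commutes with [a].

    If [a] and [b] commute, then q = a * b = b * a is a two-sided identity for
    [d], and the equalities of ideals factor q through [d] on both sides; a left
    and a right inverse of [d] relative to q combine into a group inverse
    ([group_inverse_of_sided]), with spectral idempotent 1 - q.

    If [d] has a group inverse [e] and [a] commutes with q = e * d, the Peirce
    decomposition of [a] has no mixed terms, so a = q a q + p a p with
    p = 1 - q, and [b] inverts q a q in the corner.

    Finally, in a decomposition a = x + m as in the third condition the part
    [m] is annihilated by the inverse y of x in qRq.  So y is an inverse of [a]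
    along [d] that commutes with [a] ([inverse_along_corner_unit]), and
    uniqueness of the inverse along [d] identifies it with [b]. *)

(** The right multiples of [b] are fixed by [b * a], and [d] is one of them. *)
Lemma inverse_alongKl (R : pzRingType) (a d b : R) :
  is_inverse_along a d b -> b * a * d = d.
Proof.
move=> [bab bd _].
have [t ->] : right_ideal b d by apply/bd; exists 1; rewrite mulr1.
by rewrite mulrA -bab.
Qed.

Lemma inverse_alongKr (R : pzRingType) (a d b : R) :
  is_inverse_along a d b -> d * a * b = d.
Proof.
move=> [bab _ bd].
have [t ->] : left_ideal b d by apply/bd; exists 1; rewrite mul1r.
by rewrite -!mulrA (mulrA b) -bab.
Qed.

(** As for units of a ring, a left inverse [z] and a right inverse [y] relative
    to a two-sided identity [q] of [d] give a two-sided one.  As [y] and [z]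
    may stick out of the corner qRq, the group inverse is not [y] or [z] but
    [z * d * y], which equals both q y and z q. *)
Lemma group_inverse_of_sided (R : pzRingType) (d q y z : R) :
  q * d = d -> d * q = d -> d * y = q -> z * d = q ->
  is_group_inverse d (z * d * y) /\ z * d * y * d = q.
Proof.
move=> qd dq dy zd.
have qq : q * q = q by rewrite -{1}zd -mulrA dq zd.
have de : d * (z * d * y) = q by rewrite zd mulrA dq dy.
have ed : z * d * y * d = q by rewrite -(mulrA z) dy -mulrA qd zd.
split=> //; split; rewrite ?de ?ed //.
by rewrite zd mulrA qq.
Qed.

(** The complementary part [m] is killed by the corner, so only the unit [x] of
    qRq is seen by its inverse [y] there; and units of qRq generate the same
    one-sided ideals as [d]. *)
Lemma inverse_along_corner_unit (R : pzRingType) (d e x m y : R) :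
  let q := e * d in
  is_group_inverse d e ->
  corner q y -> x * y = q -> y * x = q -> corner (1 - q) m ->
  is_inverse_along (x + m) d y /\ (x + m) * y = y * (x + m).
Proof.
move=> q [ded ede de] [r yE] xy yx [s mE].
have qd : q * d = d by rewrite /q -de.
have dq : d * q = d by rewrite /q mulrA.
have qq : q * q = q by rewrite /q mulrA ede.
have ed : e * d = q by [].
rewrite ed in de; clearbody q.
have qy : q * y = y by rewrite yE !mulrA qq.
have yq : y * q = y by rewrite yE -!mulrA qq.
have yp : y * (1 - q) = 0 by rewrite mulrBr mulr1 yq subrr.
have py : (1 - q) * y = 0 by rewrite mulrBl mul1r qy subrr.
have ym : y * m = 0 by rewrite mE !mulrA yp !mul0r.
have my : m * y = 0 by rewrite mE -!mulrA py !mulr0.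
have ya : y * (x + m) = q by rewrite mulrDr ym addr0.
have ay : (x + m) * y = q by rewrite mulrDl my addr0.
split; last by rewrite ay ya.
split=> [|t|t]; first by rewrite ya qy.
- split=> -[u ->]; [exists (e * y * u) | exists (x * d * u)].
    by rewrite !mulrA de qy.
  by rewrite !mulrA yx qd.
- split=> -[u ->]; [exists (u * y * e) | exists (u * d * x)].
    by rewrite -!mulrA ed yq.
  by rewrite -!mulrA xy dq.
Qed.

Theorem theorem6p1 (R : pzRingType) (d a a_d : R)
    (d_regular : regular d) (a_dP : is_inverse_along a d a_d) :
  [<-> a * a_d = a_d * a;
       exists d_sharp : R, is_group_inverse d d_sharp /\
         let p := 1 - d_sharp * d in a * p = p * a;
       exists d_sharp : R, is_group_inverse d d_sharp /\
         let p := 1 - d_sharp * d in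
         exists x m : R, [/\ a = x + m, corner_unit (1 - p) x & corner p m]].
Proof.
have bad := inverse_alongKl a_dP; have dab := inverse_alongKr a_dP.
have [_ rid lid] := a_dP.
have [r bdr] : right_ideal d a_d by apply/rid; exists 1; rewrite mulr1.
have [s bsd] : left_ideal d a_d by apply/lid; exists 1; rewrite mul1r.
tfae.
- move=> ab.
  (* The relative inverses come from [a_d = d * r] and [a_d = s * d]. *)
  have [|||| eP ed] := @group_inverse_of_sided R d (a_d * a) (r * a) (a * s).
  + exact: bad.
  + by rewrite -ab mulrA.
  + by rewrite mulrA -bdr.
  + by rewrite -mulrA -bsd.
  exists (a * s * d * (r * a)); split=> //=.
  by rewrite ed mulrBr mulrBl mulr1 mul1r mulrA ab.
- move=> [e [eP /= ap]]; exists e; split=> //=.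
  have [ded ede de] := eP.
  rewrite subKr; set q := e * d in ap *; set p := 1 - q in ap *.
  have aq : a * q = q * a.
    by apply: oppr_inj; apply: (addrI a); move: ap; rewrite mulrBr mulrBl mulr1 mul1r.
  have qq : q * q = q by rewrite /q mulrA ede.
  have pp : p * p = p by rewrite mulrBr mulr1 mulrBl mul1r qq subrr subr0.
  have qb : q * a_d = a_d by rewrite bdr /q -de !mulrA ded.
  have bq : a_d * q = a_d by rewrite bsd /q -(mulrA s) (mulrA d) ded.
  have qab : q * a * a_d = q by rewrite /q -!mulrA (mulrA d) dab.
  have baq : a_d * a * q = q by rewrite /q -de mulrA bad.
  have qDp : q + p = 1 by rewrite addrC subrK.
  clearbody p q.
  exists (q * a * q), (p * a * p); split; last by exists a.
    by rewrite -aq -ap -!mulrA qq pp -mulrDr qDp mulr1.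
  split; first by exists a.
  exists a_d; split; first by exists a_d; rewrite qb bq.
    by rewrite -mulrA qb qab.
  by rewrite !mulrA bq baq.
- move=> [e [eP /=]]; rewrite subKr => -[x [m [aE [_ [y [yP xy yx]]] mP]]].
  have [yinv] := inverse_along_corner_unit eP yP xy yx mP.
  rewrite -aE in yinv *.
  by rewrite (inverse_along_uniq a_dP yinv).
Qed.
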